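(* Let $\mathfrak{Q}=(\mathfrak{Q},\ast,{}^{\prime})$ be an involutive quantale with associated involutive quantaloid $(D\mathfrak{Q},j)$. If the Cauchy completion with respect to $D\mathfrak{Q}$ preserves the symmetry axiom, then $\mathtt{Set}(\mathfrak{Q})$ is an (epi, extremal mono)-category.
   Context: **Quantales.** A quantale $(\mathfrak{Q},\ast)$ is a complete lattice with an associative multiplication preserving arbitrary joins in each variable (not necessarily unital); it is involutive if equipped with a join-preserving map ${}^{\prime}$ with $a^{\prime\prime}=a$ and $(a\ast b)^{\prime}=b^{\prime}\ast a^{\prime}$. Residuals: $a\searrow b=\bigvee\{c\mid a\ast c\le b\}$, $b\swarrow a=\bigvee\{c\mid c\ast a\le b\}$. An element $a$ is hermitian if $a^{\prime}=a$, and self-divisible if it is both a left and a right divisor of itself ($a=a\ast c$ and $a=d\ast a$ for some $c,d\in\mathfrak{Q}$). **The quantaloid $D\mathfrak{Q}$.** A quantaloid is a category whose hom-sets are complete lattices and whose composition preserves arbitrary joins in each variable. $D\mathfrak{Q}$ has as object set $D\mathfrak{Q}_0$ all self-divisible hermitian elements of $\mathfrak{Q}$; $\hom(a,b)=\{\lambda\in\mathfrak{Q}\mid\lambda=(\lambda\swarrow a)\ast a=b\ast(b\searrow\lambda)\}$, ordered as in $\mathfrak{Q}$ (morphisms are regarded together with their domain and codomain); composition of $\lambda\in\hom(a,b)$ and $\mu\in\hom(b,c)$ is $\mu\circ_b\lambda=\mu\ast(b\searrow\lambda)=(\mu\swarrow b)\ast\lambda$; the identity of $a$ is $a$; the involution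 $j$ is the identity on objects and sends $\lambda\in\hom(a,b)$ to $\lambda^{\prime}\in\hom(b,a)$. **$D\mathfrak{Q}$-categories and distributors.** Write $\mathcal{Q}=D\mathfrak{Q}$, $\circ$ for its composition, $1_p$ for identities. A $\mathcal{Q}$-category $(X,\alpha)$ is a set $X_0$ with a type map $|\cdot|\colon X_0\to\mathcal{Q}_0$ and a morphism-valued map $\alpha$ on $X_0\times X_0$ with $\alpha(x,y)\in\hom(|y|,|x|)$, $\alpha(x,y)\circ\alpha(y,z)\le\alpha(x,z)$, $1_{|x|}\le\alpha(x,x)$. It is symmetric if $\alpha(x,y)=j(\alpha(y,x))$. A distributor $\Phi$ from $(X,\alpha)$ to $(Y,\beta)$ assigns $\Phi(y,x)\in\hom(|x|,|y|)$ to $(y,x)\in Y_0\times X_0$ with $\beta(y_1,y_2)\circ\Phi(y_2,x)\le\Phi(y_1,x)$ and $\Phi(y,x_1)\circ\alpha(x_1,x_2)\le\Phi(y,x_2)$; composition is $(\Psi\otimes\Phi)(z,x)=\bigvee_{y}\Psi(z,y)\circ\Phi(y,x)$, with identity $\alpha$. $\Phi$ is left adjoint if there is a distributor $\Psi$ from $(Y,\beta)$ to $(X,\alpha)$ with $\alpha\le\Psi\otimes\Phi$ and $\Phi\otimes\Psi\le\beta$ pointwise. **Cauchy completion.** A presingleton of $(X,\alpha)$ is a triple $(f,p,g)$ with $p\in\mathcal{Q}_0$, $f(x)\in\hom(|x|,p)$, $g(x)\in\hom(p,|x|)$ for $x\in X_0$, such that $f(x_1)\circ\alpha(x_1,x_2)\le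 f(x_2)$, $\alpha(x_1,x_2)\circ g(x_2)\le g(x_1)$, $1_p\le\bigvee_x f(x)\circ g(x)$ and $g(x_1)\circ f(x_2)\le\alpha(x_1,x_2)$. The Cauchy completion of $(X,\alpha)$ is the $\mathcal{Q}$-category $(\widehat X,\widehat\alpha)$ of all presingletons with type $|(f,p,g)|=p$ and $\widehat{\alpha}((f_1,p_1,g_1),(f_2,p_2,g_2))=\bigvee_x f_1(x)\circ g_2(x)$. The Cauchy completion preserves the symmetry axiom if the Cauchy completion of every symmetric $\mathcal{Q}$-category is symmetric. **$\mathfrak{Q}$-valued sets.** A $\mathfrak{Q}$-valued set $(X_0,\varepsilon)$ is a set $X_0$ with a map $\varepsilon\colon X_0\times X_0\to\mathfrak{Q}$ such that for all $x,y,z$: $\varepsilon(x,x)\ast(\varepsilon(x,x)\searrow\varepsilon(x,y))=\varepsilon(x,y)=(\varepsilon(x,y)\swarrow\varepsilon(y,y))\ast\varepsilon(y,y)$; $\varepsilon(x,y)\ast(\varepsilon(y,y)\searrow\varepsilon(y,z))\le\varepsilon(x,z)$; and $\varepsilon(x,y)=\varepsilon(y,x)^{\prime}$. It is identified with the symmetric $D\mathfrak{Q}$-category $(X,\alpha)$ with type map $|x|=\varepsilon(x,x)$ and $\alpha(x,y)=\varepsilon(x,y)\in\hom(\varepsilon(y,y),\varepsilon(x,x))$. $\mathtt{Set}(\mathfrak{Q})$ is the category of $\mathfrak{Q}$-valued sets with left adjoint distributors (between the corresponding $D\mathfrak{Q}$-categories) as morphisms and composition $\otimes$. **Factorization.**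 A monomorphism $m$ is extremal if, whenever $m=f\circ e$ with $e$ an epimorphism, $e$ is an isomorphism. A category is an (epi, extremal mono)-category if every morphism factors as an epimorphism followed by an extremal monomorphism, and this factorization is unique up to isomorphism: if $m_1\circ e_1=m_2\circ e_2$ are two such factorizations, there is an isomorphism $h$ with $h\circ e_1=e_2$ and $m_2\circ h=m_1$. *)

(* Defs.v *)
From HB Require Import structures.
From mathcomp Require Import all_boot all_order.
From mathcomp Require Import boolp classical_sets.

Set Implicit Arguments.
Unset Strict Implicit.
Unset Printing Implicit Defensive.

Import Order.TTheory.

Local Open Scope classical_set_scope.
Local Open Scope order_scope.

Declare Scope quantale_scope.
Delimit Scope quantale_scope with Q.
Local Open Scope quantale_scope.

Reserved Notation "\bigvee_ x F" (at level 41, x name, F at level 41,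
  format "'[' \bigvee_ x '/  '  F ']'").
Reserved Notation "a ↘ b" (at level 45, no associativity).
Reserved Notation "b ↙ a" (at level 45, no associativity).
Reserved Notation "g ∘ f" (at level 40, left associativity).
Reserved Notation "P ⊗ F" (at level 40, left associativity).

(* The decidable equality and choice operator that come with [porderType] are
   no restriction: [boolp] provides them classically on every type. *)
HB.mixin Record POrder_isCompleteLattice d T of Order.POrder d T := {
  bigjoin : set T -> T ;
  bigjoin_supremums : forall A : set T, supremums A (bigjoin A)
}.

#[short(type="completeLatticeType")]
HB.structure Definition CompleteLattice d :=
  {T of POrder_isCompleteLattice d T & Order.POrder d T}.

Notation "\bigvee_ x F" := (bigjoin (range (fun x => F))) : quantale_scope.

(* The multiplication is the one of MathComp's [semigroupType], which has
   no unit. *)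
HB.mixin Record isQuantale d T of CompleteLattice d T & Semigroup T := {
  mul_bigjoinl : forall (A : set T) (b : T),
    (bigjoin A * b)%g = bigjoin [set (a * b)%g | a in A] ;
  mul_bigjoinr : forall (a : T) (B : set T),
    (a * bigjoin B)%g = bigjoin [set (a * b)%g | b in B]
}.

#[short(type="quantaleType")]
HB.structure Definition Quantale d :=
  {T of isQuantale d T & CompleteLattice d T & Semigroup T}.

HB.mixin Record isInvolutiveQuantale d T of Quantale d T := {
  invol : T -> T ;
  invol_bigjoin : forall A : set T, invol (bigjoin A) = bigjoin (invol @` A) ;
  involK : forall a : T, invol (invol a) = a ;
  involM : forall a b : T, invol (a * b)%g = (invol b * invol a)%g
}.

#[short(type="involutiveQuantaleType")]
HB.structure Definition InvolutiveQuantale d :=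
  {T of isInvolutiveQuantale d T & Quantale d T}.

Definition rresidual d (Q : quantaleType d) (a b : Q) : Q :=
  bigjoin [set c | (a * c)%g <= b].

Definition lresidual d (Q : quantaleType d) (b a : Q) : Q :=
  bigjoin [set c | (c * a)%g <= b].

Notation "a ↘ b" := (rresidual a b) : quantale_scope.
Notation "b ↙ a" := (lresidual b a) : quantale_scope.

Definition hermitian d (Q : involutiveQuantaleType d) (a : Q) : Prop :=
  invol a = a.

Definition self_divisible d (Q : quantaleType d) (a : Q) : Prop :=
  (exists c : Q, a = (a * c)%g) /\ (exists c : Q, a = (c * a)%g).

Section CompleteLatticeTheory.
Context d (L : completeLatticeType d).
Implicit Types (A B : set L) (x : L).

Lemma bigjoin_ub A x : A x -> x <= bigjoin A.
Proof. by move=> Ax; case: (bigjoin_supremums A) => + _; apply. Qed.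

Lemma bigjoin_le A x : (forall y, A y -> y <= x) -> bigjoin A <= x.
Proof. by move=> h; case: (bigjoin_supremums A) => _; apply. Qed.

Lemma bigjoin_unique A x : supremums A x -> bigjoin A = x.
Proof.
case=> ub lub; apply/le_anti/andP; split; first exact: bigjoin_le.
by apply: lub => y; apply: bigjoin_ub.
Qed.

Lemma bigjoin_subset A B : A `<=` B -> bigjoin A <= bigjoin B.
Proof. by move=> AB; apply: bigjoin_le => y /AB; apply: bigjoin_ub. Qed.

Lemma bigvee_ub I (F : I -> L) i : F i <= \bigvee_i F i.
Proof. by apply: bigjoin_ub; exists i. Qed.

Lemma bigvee_ub_le I (F : I -> L) i x : x <= F i -> x <= \bigvee_i F i.
Proof. by move=> /le_trans; apply; apply: bigvee_ub. Qed.

Lemma bigvee_le I (F : I -> L) x : (forall i, F i <= x) -> \bigvee_i F i <= x.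
Proof. by move=> h; apply: bigjoin_le => _ [i _ <-]. Qed.

Lemma le_bigvee I (F G : I -> L) :
  (forall i, F i <= G i) -> \bigvee_i F i <= \bigvee_i G i.
Proof. by move=> h; apply: bigvee_le => i; apply: bigvee_ub_le (h i). Qed.

Lemma eq_bigvee I (F G : I -> L) :
  (forall i, F i = G i) -> \bigvee_i F i = \bigvee_i G i.
Proof. by move=> /funext ->. Qed.

Lemma bigvee_exchange I J (F : I -> J -> L) :
  \bigvee_i (\bigvee_j F i j) = \bigvee_j (\bigvee_i F i j).
Proof.
by apply/le_anti/andP; split; apply: bigvee_le => u; apply: bigvee_le => v;
  apply: (@bigvee_ub_le _ _ v); apply: bigvee_ub_le.
Qed.

Lemma bigjoin_pair x y : x <= y -> bigjoin [set x; y] = y.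
Proof.
move=> xy; apply: bigjoin_unique; split; first by move=> z [] ->.
by move=> z; apply; right.
Qed.

End CompleteLatticeTheory.

Lemma join_preserving_le d d' (L : completeLatticeType d)
    (M : completeLatticeType d') (f : L -> M) :
  (forall A, f (bigjoin A) = bigjoin (f @` A)) -> {homo f : x y / x <= y}.
Proof.
move=> fJ x y xy; rewrite -(bigjoin_pair xy) fJ.
by apply: bigjoin_ub; exists x => //; left.
Qed.

Section QuantaleTheory.
Context d (Q : quantaleType d).
Implicit Types a b c : Q.

Lemma mulq_le a a' b b' : a <= a' -> b <= b' -> (a * b)%g <= (a' * b')%g.
Proof.
move=> aa' bb'; apply: (@le_trans _ _ (a' * b)%g).
  exact: (@join_preserving_le _ _ _ _ (fun u => u * b)%g
           (fun A => mul_bigjoinl A b)).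
exact: (@join_preserving_le _ _ _ _ (fun u => a' * u)%g (mul_bigjoinr a')).
Qed.

Lemma mulq_rresidual_le a b : (a * (a ↘ b))%g <= b.
Proof. by rewrite mul_bigjoinr; apply: bigjoin_le => _ [c /= ? <-]. Qed.

Lemma mulq_lresidual_le a b : ((b ↙ a) * a)%g <= b.
Proof. by rewrite mul_bigjoinl; apply: bigjoin_le => _ [c /= ? <-]. Qed.

Lemma le_rresidual a b c : (c <= a ↘ b) = ((a * c)%g <= b).
Proof.
apply/idP/idP => [h|h]; last exact: bigjoin_ub.
exact: le_trans (mulq_le (lexx a) h) (mulq_rresidual_le a b).
Qed.

Lemma le_lresidual a b c : (c <= b ↙ a) = ((c * a)%g <= b).
Proof.
apply/idP/idP => [h|h]; last exact: bigjoin_ub.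
exact: le_trans (mulq_le h (lexx a)) (mulq_lresidual_le a b).
Qed.

Lemma rdivisibleP a b : (exists c, b = (a * c)%g) -> b = (a * (a ↘ b))%g.
Proof.
case=> c bE; apply/le_anti; rewrite mulq_rresidual_le andbT {1}bE.
by apply: mulq_le => //; rewrite le_rresidual -bE.
Qed.

Lemma ldivisibleP a b : (exists c, b = (c * a)%g) -> b = ((b ↙ a) * a)%g.
Proof.
case=> c bE; apply/le_anti; rewrite mulq_lresidual_le andbT {1}bE.
by apply: mulq_le => //; rewrite le_lresidual -bE.
Qed.

End QuantaleTheory.

Record quantaloid d := Quantaloid {
  qobj : Type ;
  qhom : qobj -> qobj -> completeLatticeType d ;
  qcomp : forall a b c, qhom b c -> qhom a b -> qhom a c ;
  qid : forall a, qhom a a ;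
  qcompA : forall a b c e (h : qhom c e) (g : qhom b c) (f : qhom a b),
    qcomp h (qcomp g f) = qcomp (qcomp h g) f ;
  qcomp1l : forall a b (f : qhom a b), qcomp (qid b) f = f ;
  qcomp1r : forall a b (f : qhom a b), qcomp f (qid a) = f ;
  qcomp_bigjoinl : forall a b c (A : set (qhom b c)) (f : qhom a b),
    qcomp (bigjoin A) f = bigjoin [set qcomp g f | g in A] ;
  qcomp_bigjoinr : forall a b c (g : qhom b c) (A : set (qhom a b)),
    qcomp g (bigjoin A) = bigjoin [set qcomp g f | f in A]
}.

Notation "g ∘ f" := (qcomp g f) : quantale_scope.

(* Only involutions that are the identity on objects are considered, as is the
   one of [DQ] below. *)
Record involutive_quantaloid d := InvolutiveQuantaloid {
  iq_quantaloid :> quantaloid d ;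
  qinv : forall a b : qobj iq_quantaloid, qhom a b -> qhom b a ;
  qinvK : forall a b (f : qhom a b), qinv (qinv f) = f ;
  qinv_id : forall a : qobj iq_quantaloid, qinv (qid a) = qid a ;
  qinv_comp : forall a b c (g : qhom b c) (f : qhom a b),
    qinv (g ∘ f) = qinv f ∘ qinv g ;
  qinv_bigjoin : forall a b (A : set (qhom a b)),
    qinv (bigjoin A) = bigjoin [set qinv f | f in A]
}.

Section QuantaloidTheory.
Context d (K : quantaloid d).

Lemma qcomp_le (a b c : qobj K) (g g' : qhom b c) (f f' : qhom a b) :
  g <= g' -> f <= f' -> g ∘ f <= g' ∘ f'.
Proof.
move=> gg' ff'; apply: (@le_trans _ _ (g' ∘ f)).
  exact: (@join_preserving_le _ _ _ _ (fun u => u ∘ f)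
           (fun A => qcomp_bigjoinl A f)).
exact: (@join_preserving_le _ _ _ _ (fun u => g' ∘ u)
         (fun A => qcomp_bigjoinr g' A)).
Qed.

Lemma qcomp_bigveel (a b c : qobj K) I (G : I -> qhom b c) (f : qhom a b) :
  (\bigvee_i G i) ∘ f = \bigvee_i (G i ∘ f).
Proof. by rewrite qcomp_bigjoinl image_comp. Qed.

Lemma qcomp_bigveer (a b c : qobj K) I (g : qhom b c) (F : I -> qhom a b) :
  g ∘ (\bigvee_i F i) = \bigvee_i (g ∘ F i).
Proof. by rewrite qcomp_bigjoinr image_comp. Qed.

End QuantaloidTheory.

Record dq_obj d (Q : involutiveQuantaleType d) := DqObj {
  dq_elt :> Q ;
  dq_elt_hermitian : hermitian dq_elt ;
  dq_elt_self_divisible : self_divisible dq_elt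
}.

(* In [is_dq_hom a b l], [a] is the domain and [b] the codomain. *)
Definition is_dq_hom d (Q : quantaleType d) (a b : Q) : pred Q :=
  fun l => (l == ((l ↙ a) * a)%g) && (l == (b * (b ↘ l))%g).

Record dq_hom d (Q : involutiveQuantaleType d) (a b : dq_obj Q) := DqHom {
  dq_val :> Q ;
  dq_valP : is_dq_hom (a : Q) (b : Q) dq_val
}.

HB.instance Definition _ d (Q : involutiveQuantaleType d) (a b : dq_obj Q) :=
  [isSub for @dq_val d Q a b].
HB.instance Definition _ d (Q : involutiveQuantaleType d) (a b : dq_obj Q) :=
  [Choice of dq_hom a b by <:].
HB.instance Definition _ d (Q : involutiveQuantaleType d) (a b : dq_obj Q) :=
  [SubChoice_isSubPOrder of dq_hom a b by <: with d].

Section DQ.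
Context d (Q : involutiveQuantaleType d).
Implicit Types a b c e : dq_obj Q.

Lemma is_dq_homP (a b l : Q) :
  reflect ((exists u, l = (u * a)%g) /\ (exists u, l = (b * u)%g))
          (is_dq_hom a b l).
Proof.
apply: (iffP andP) => [[/eqP ? /eqP ?]|[/ldivisibleP ? /rdivisibleP ?]].
  by split; [exists (l ↙ a)|exists (b ↘ l)].
by split; apply/eqP.
Qed.

Lemma dq_hom_src a b (l : dq_hom a b) : (l : Q) = (((l : Q) ↙ (a : Q)) * (a : Q))%g.
Proof. by have /andP[/eqP] := dq_valP l. Qed.

Lemma dq_hom_tgt a b (l : dq_hom a b) :
  (l : Q) = ((b : Q) * ((b : Q) ↘ (l : Q)))%g.
Proof. by have /andP[_ /eqP] := dq_valP l. Qed.

Lemma dq_hom_inj a b (l m : dq_hom a b) : (l : Q) = m -> l = m.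
Proof. exact: val_inj. Qed.

(* Joins in hom(a, b) are computed in Q. *)
Fact dq_bigjoin_subproof a b (A : set (dq_hom a b)) :
  is_dq_hom (a : Q) (b : Q) (bigjoin [set (l : Q) | l in A]).
Proof.
apply/andP; split; apply/eqP/le_anti;
  rewrite ?mulq_lresidual_le ?mulq_rresidual_le andbT;
  apply: bigjoin_le => _ [l Al <-].
  rewrite {1}(dq_hom_src l); apply: mulq_le => //.
  rewrite le_lresidual -dq_hom_src.
  by apply: bigjoin_ub; exists l.
rewrite {1}(dq_hom_tgt l); apply: mulq_le => //.
rewrite le_rresidual -dq_hom_tgt.
by apply: bigjoin_ub; exists l.
Qed.

Definition dq_bigjoin a b (A : set (dq_hom a b)) : dq_hom a b :=
  DqHom (dq_bigjoin_subproof A).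

Fact dq_bigjoin_supremums a b (A : set (dq_hom a b)) :
  supremums A (dq_bigjoin A).
Proof.
split=> [l Al|m ubm]; rewrite leEsub /=.
  by apply: bigjoin_ub; exists l.
by apply: bigjoin_le => _ [l Al <-]; have := ubm l Al; rewrite leEsub.
Qed.

HB.instance Definition _ a b :=
  POrder_isCompleteLattice.Build d (dq_hom a b) (@dq_bigjoin_supremums a b).

(* The two expressions of the composite of [l] and [m] agree. *)
Lemma dq_comp_lresidual a b c (m : dq_hom b c) (l : dq_hom a b) :
  ((m : Q) * ((b : Q) ↘ (l : Q)) = ((m : Q) ↙ (b : Q)) * (l : Q))%g.
Proof. by rewrite {1}(dq_hom_src m) -mulgA -dq_hom_tgt. Qed.

Fact dq_comp_subproof a b c (m : dq_hom b c) (l : dq_hom a b) :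
  is_dq_hom (a : Q) (c : Q) ((m : Q) * ((b : Q) ↘ (l : Q)))%g.
Proof.
apply/is_dq_homP; split.
  rewrite dq_comp_lresidual {1}(dq_hom_src l) mulgA.
  by eexists; reflexivity.
by rewrite (dq_hom_tgt m) -mulgA; eexists; reflexivity.
Qed.

Definition dq_comp a b c (m : dq_hom b c) (l : dq_hom a b) : dq_hom a c :=
  DqHom (dq_comp_subproof m l).

Fact dq_id_subproof a : is_dq_hom (a : Q) (a : Q) (a : Q).
Proof. by apply/is_dq_homP; have [] := dq_elt_self_divisible a. Qed.

Definition dq_id a : dq_hom a a := DqHom (dq_id_subproof a).

Fact dq_inv_subproof a b (l : dq_hom a b) :
  is_dq_hom (b : Q) (a : Q) (invol (l : Q)).
Proof.
apply/is_dq_homP; split.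
  exists (invol ((b : Q) ↘ (l : Q))).
  by rewrite {1}(dq_hom_tgt l) involM dq_elt_hermitian.
exists (invol ((l : Q) ↙ (a : Q))).
by rewrite {1}(dq_hom_src l) involM dq_elt_hermitian.
Qed.

Definition dq_inv a b (l : dq_hom a b) : dq_hom b a :=
  DqHom (dq_inv_subproof l).

Lemma dq_compA a b c e (n : dq_hom c e) (m : dq_hom b c) (l : dq_hom a b) :
  dq_comp n (dq_comp m l) = dq_comp (dq_comp n m) l.
Proof.
apply: dq_hom_inj; rewrite [LHS]dq_comp_lresidual /=.
by rewrite (dq_comp_lresidual n m) mulgA.
Qed.

Lemma dq_comp1l a b (l : dq_hom a b) : dq_comp (dq_id b) l = l.
Proof. by apply: dq_hom_inj; rewrite /= -dq_hom_tgt. Qed.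

Lemma dq_comp1r a b (l : dq_hom a b) : dq_comp l (dq_id a) = l.
Proof.
by apply: dq_hom_inj; rewrite [LHS]dq_comp_lresidual /= -dq_hom_src.
Qed.

Lemma dq_comp_bigjoinl a b c (A : set (dq_hom b c)) (l : dq_hom a b) :
  dq_comp (bigjoin A) l = bigjoin [set dq_comp m l | m in A].
Proof.
apply: dq_hom_inj; rewrite /= mul_bigjoinl; congr bigjoin.
by rewrite !image_comp.
Qed.

Lemma dq_comp_bigjoinr a b c (m : dq_hom b c) (A : set (dq_hom a b)) :
  dq_comp m (bigjoin A) = bigjoin [set dq_comp m l | l in A].
Proof.
apply: dq_hom_inj; rewrite [LHS]dq_comp_lresidual /= mul_bigjoinr.
congr bigjoin; rewrite !image_comp.
by apply: eq_imagel => l _ /=; rewrite dq_comp_lresidual.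
Qed.

Lemma dq_invK a b (l : dq_hom a b) : dq_inv (dq_inv l) = l.
Proof. by apply: dq_hom_inj; rewrite /= involK. Qed.

Lemma dq_inv_id a : dq_inv (dq_id a) = dq_id a.
Proof. by apply: dq_hom_inj; rewrite /= dq_elt_hermitian. Qed.

Lemma invol_le (x y : Q) : (invol x <= invol y) = (x <= y).
Proof.
have h := join_preserving_le (@invol_bigjoin d Q).
by apply/idP/idP => /h; rewrite ?involK.
Qed.

Lemma invol_rresidual (x y : Q) : invol (x ↘ y) = invol y ↙ invol x.
Proof.
apply/le_anti/andP; split.
  by rewrite le_lresidual -involM invol_le mulq_rresidual_le.
rewrite -invol_le involK le_rresidual -invol_le involM involK.
exact: mulq_lresidual_le.
Qed.

Lemma dq_inv_comp a b c (m : dq_hom b c) (l : dq_hom a b) :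
  dq_inv (dq_comp m l) = dq_comp (dq_inv l) (dq_inv m).
Proof.
apply: dq_hom_inj; rewrite [RHS]dq_comp_lresidual /= involM invol_rresidual.
by rewrite dq_elt_hermitian.
Qed.

Lemma dq_inv_bigjoin a b (A : set (dq_hom a b)) :
  dq_inv (bigjoin A) = bigjoin [set dq_inv l | l in A].
Proof.
apply: dq_hom_inj; rewrite /= invol_bigjoin; congr bigjoin.
by rewrite !image_comp.
Qed.

Definition dq_quantaloid : quantaloid d :=
  @Quantaloid d (dq_obj Q) (fun a b => dq_hom a b) dq_comp dq_id
    dq_compA dq_comp1l dq_comp1r dq_comp_bigjoinl dq_comp_bigjoinr.

Definition DQ : involutive_quantaloid d :=
  @InvolutiveQuantaloid d dq_quantaloid dq_inv
    dq_invK dq_inv_id dq_inv_comp dq_inv_bigjoin.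

End DQ.

(* [alpha x y] goes from the type of [y] to the type of [x]. *)
Record qcategory d (K : quantaloid d) := QCategory {
  qcarrier :> Type ;
  qtype : qcarrier -> qobj K ;
  alpha : forall x y : qcarrier, qhom (qtype y) (qtype x) ;
  alpha_comp : forall x y z, alpha x y ∘ alpha y z <= alpha x z ;
  alpha_id : forall x, qid (qtype x) <= alpha x x
}.

Definition qsymmetric d (K : involutive_quantaloid d) (X : qcategory K)
    : Prop :=
  forall x y : X, alpha x y = qinv (alpha y x).

(* A distributor from [X] to [Y] takes its argument in [Y] first. *)
Record distributor d (K : quantaloid d) (X Y : qcategory K) := Distributor {
  dist :> forall (y : Y) (x : X), qhom (qtype x) (qtype y) ;
  dist_actl : forall (y1 y2 : Y) (x : X),
    alpha y1 y2 ∘ dist y2 x <= dist y1 x ;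
  dist_actr : forall (y : Y) (x1 x2 : X),
    dist y x1 ∘ alpha x1 x2 <= dist y x2
}.

Section Distributors.
Context d (K : quantaloid d).
Implicit Types X Y Z W : qcategory K.

Lemma distributor_eq X Y (F G : distributor X Y) :
  (forall y x, F y x = G y x) -> F = G.
Proof.
case: F G => [F Fl Fr] [G Gl Gr] /= FG.
have E : F = G.
  by apply: functional_extensionality_dep => y;
    apply: functional_extensionality_dep => x.
by subst G; congr Distributor; apply: Prop_irrelevance.
Qed.

Section Composition.
Context X Y Z (P : distributor Y Z) (F : distributor X Y).

Definition dcomp_fun (z : Z) (x : X) : qhom (qtype x) (qtype z) :=
  \bigvee_y (P z y ∘ F y x).

Fact dcomp_actl z1 z2 x : alpha z1 z2 ∘ dcomp_fun z2 x <= dcomp_fun z1 x.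
Proof.
rewrite qcomp_bigveer; apply: le_bigvee => y; rewrite qcompA.
by apply: qcomp_le => //; apply: dist_actl.
Qed.

Fact dcomp_actr z x1 x2 : dcomp_fun z x1 ∘ alpha x1 x2 <= dcomp_fun z x2.
Proof.
rewrite qcomp_bigveel; apply: le_bigvee => y; rewrite -qcompA.
by apply: qcomp_le => //; apply: dist_actr.
Qed.

Definition dcomp : distributor X Z := Distributor dcomp_actl dcomp_actr.

End Composition.

Local Notation "P ⊗ F" := (dcomp P F) : quantale_scope.

Definition did X : distributor X X :=
  Distributor (@alpha_comp d K X) (@alpha_comp d K X).

Lemma dcompA X Y Z W (H : distributor Z W) (G : distributor Y Z)
    (F : distributor X Y) :
  H ⊗ (G ⊗ F) = (H ⊗ G) ⊗ F.
Proof.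
apply: distributor_eq => w x /=; rewrite /dcomp_fun /= /dcomp_fun.
under eq_bigvee do rewrite qcomp_bigveer.
under [RHS]eq_bigvee do rewrite qcomp_bigveel.
rewrite bigvee_exchange; apply: eq_bigvee => y; apply: eq_bigvee => z.
exact: qcompA.
Qed.

Lemma dcomp1l X Y (F : distributor X Y) : did Y ⊗ F = F.
Proof.
apply: distributor_eq => y x; apply/le_anti/andP; split.
  by apply: bigvee_le => y'; apply: dist_actl.
apply: (@bigvee_ub_le _ _ _ _ y).
by rewrite -{1}[F y x]qcomp1l; apply: qcomp_le => //; apply: alpha_id.
Qed.

Lemma dcomp1r X Y (F : distributor X Y) : F ⊗ did X = F.
Proof.
apply: distributor_eq => y x; apply/le_anti/andP; split.
  by apply: bigvee_le => x'; apply: dist_actr.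
apply: (@bigvee_ub_le _ _ _ _ x).
by rewrite -{1}[F y x]qcomp1r; apply: qcomp_le => //; apply: alpha_id.
Qed.

Definition dle X Y (F G : distributor X Y) : Prop :=
  forall y x, F y x <= G y x.

Lemma dle_trans X Y (F G H : distributor X Y) :
  dle F G -> dle G H -> dle F H.
Proof. by move=> FG GH y x; apply: le_trans (FG y x) (GH y x). Qed.

Lemma dcomp_le X Y Z (P P' : distributor Y Z) (F F' : distributor X Y) :
  dle P P' -> dle F F' -> dle (P ⊗ F) (P' ⊗ F').
Proof. by move=> PP FF z x; apply: le_bigvee => y; apply: qcomp_le. Qed.

Definition left_adjoint X Y (F : distributor X Y) : Prop :=
  exists P : distributor Y X, dle (did X) (P ⊗ F) /\ dle (F ⊗ P) (did Y).

Lemma left_adjoint_id X : left_adjoint (did X).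
Proof. by exists (did X); rewrite dcomp1l; split. Qed.

Lemma left_adjoint_comp X Y Z (G : distributor Y Z) (F : distributor X Y) :
  left_adjoint G -> left_adjoint F -> left_adjoint (G ⊗ F).
Proof.
case=> R [GR RG] [P [FP PF]]; exists (P ⊗ R); split.
  rewrite -dcompA (dcompA R); apply: dle_trans FP _.
  apply: dcomp_le => //; rewrite -{1}[F]dcomp1l; exact: dcomp_le.
rewrite -dcompA (dcompA F); apply: dle_trans _ RG.
apply: dcomp_le => //; rewrite -{2}[R]dcomp1l; exact: dcomp_le.
Qed.

End Distributors.

Notation "P ⊗ F" := (dcomp P F) : quantale_scope.

Record presingleton d (K : quantaloid d) (X : qcategory K) := Presingleton {
  psobj : qobj K ;
  psf : forall x : X, qhom (qtype x) psobj ;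
  psg : forall x : X, qhom psobj (qtype x) ;
  psf_act : forall x1 x2 : X, psf x1 ∘ alpha x1 x2 <= psf x2 ;
  psg_act : forall x1 x2 : X, alpha x1 x2 ∘ psg x2 <= psg x1 ;
  ps_unit : qid psobj <= \bigvee_x (psf x ∘ psg x) ;
  ps_counit : forall x1 x2 : X, psg x1 ∘ psf x2 <= alpha x1 x2
}.

Section CauchyCompletion.
Context d (K : quantaloid d) (X : qcategory K).

Definition cauchy_alpha (s t : presingleton X) : qhom (psobj t) (psobj s) :=
  \bigvee_x (psf s x ∘ psg t x).

Fact cauchy_alpha_comp s t u :
  cauchy_alpha s t ∘ cauchy_alpha t u <= cauchy_alpha s u.
Proof.
rewrite qcomp_bigveel; apply: bigvee_le => x1.
rewrite qcomp_bigveer; apply: bigvee_le => x2.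
apply: (@bigvee_ub_le _ _ _ _ x2).
rewrite qcompA; apply: qcomp_le => //; rewrite -qcompA.
apply: le_trans (psf_act s x1 x2).
by apply: qcomp_le => //; apply: ps_counit.
Qed.

Definition cauchy_completion : qcategory K :=
  QCategory cauchy_alpha_comp (@ps_unit d K X).

End CauchyCompletion.

Definition cauchy_preserves_symmetry d (K : involutive_quantaloid d) : Prop :=
  forall X : qcategory K, qsymmetric X -> qsymmetric (cauchy_completion X).

Record category := Category {
  cobj : Type ;
  chom : cobj -> cobj -> Type ;
  ccomp : forall a b c, chom b c -> chom a b -> chom a c ;
  cid : forall a, chom a a ;
  ccompA : forall a b c e (h : chom c e) (g : chom b c) (f : chom a b),
    ccomp h (ccomp g f) = ccomp (ccomp h g) f ;
  ccomp1l : forall a b (f : chom a b), ccomp (cid b) f = f ;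
  ccomp1r : forall a b (f : chom a b), ccomp f (cid a) = f
}.

Section Factorization.
Context (C : category).

Definition monomorphism (a b : cobj C) (m : chom a b) : Prop :=
  forall (c : cobj C) (f g : chom c a), ccomp m f = ccomp m g -> f = g.

Definition epimorphism (a b : cobj C) (e : chom a b) : Prop :=
  forall (c : cobj C) (f g : chom b c), ccomp f e = ccomp g e -> f = g.

Definition isomorphism (a b : cobj C) (h : chom a b) : Prop :=
  exists k : chom b a, ccomp k h = cid a /\ ccomp h k = cid b.

Definition extremal_monomorphism (a b : cobj C) (m : chom a b) : Prop :=
  monomorphism m /\
  forall (c : cobj C) (f : chom c b) (e : chom a c),
    m = ccomp f e -> epimorphism e -> isomorphism e.

Definition epi_extremal_mono_category : Prop :=
  (forall (a b : cobj C) (f : chom a b),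
     exists (c : cobj C) (e : chom a c) (m : chom c b),
       [/\ epimorphism e, extremal_monomorphism m & f = ccomp m e]) /\
  (forall (a b c1 c2 : cobj C) (e1 : chom a c1) (m1 : chom c1 b)
      (e2 : chom a c2) (m2 : chom c2 b),
     epimorphism e1 -> extremal_monomorphism m1 ->
     epimorphism e2 -> extremal_monomorphism m2 ->
     ccomp m1 e1 = ccomp m2 e2 ->
     exists h : chom c1 c2,
       [/\ isomorphism h, ccomp h e1 = e2 & ccomp m2 h = m1]).

End Factorization.

Record valued_set d (Q : involutiveQuantaleType d) := ValuedSet {
  vcarrier :> Type ;
  eps : vcarrier -> vcarrier -> Q ;
  eps_divl : forall x y, (eps x x * (eps x x ↘ eps x y))%g = eps x y ;
  eps_divr : forall x y, eps x y = ((eps x y ↙ eps y y) * eps y y)%g ;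
  eps_trans : forall x y z, (eps x y * (eps y y ↘ eps y z))%g <= eps x z ;
  eps_sym : forall x y, eps x y = invol (eps y x)
}.

Section ValuedSetCategory.
Context d (Q : involutiveQuantaleType d).

Section Identification.
Context (X : valued_set Q).

Fact eps_self_divisible (x : X) : self_divisible (eps x x).
Proof.
split; first by exists (eps x x ↘ eps x x); rewrite eps_divl.
by exists (eps x x ↙ eps x x); rewrite -eps_divr.
Qed.

Definition vtype (x : X) : qobj (DQ Q) :=
  DqObj (esym (eps_sym x x)) (eps_self_divisible x).

Fact eps_is_dq_hom (x y : X) : is_dq_hom (eps y y) (eps x x) (eps x y).
Proof. by rewrite /is_dq_hom -eps_divr eps_divl eqxx. Qed.

Definition valpha (x y : X) : @qhom d (DQ Q) (vtype y) (vtype x) :=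
  @DqHom d Q (vtype y) (vtype x) (eps x y) (eps_is_dq_hom x y).

Fact valpha_comp (x y z : X) : valpha x y ∘ valpha y z <= valpha x z.
Proof. by rewrite leEsub; apply: eps_trans. Qed.

Fact valpha_id (x : X) : qid (vtype x) <= valpha x x.
Proof. by rewrite leEsub. Qed.

Definition qcategory_of_valued_set : qcategory (DQ Q) :=
  QCategory valpha_comp valpha_id.

Lemma qcategory_of_valued_set_sym : qsymmetric qcategory_of_valued_set.
Proof. by move=> x y; apply: dq_hom_inj; apply: eps_sym. Qed.

End Identification.

Local Notation "« X »" := (qcategory_of_valued_set X) (format "« X »").

Record set_hom (X Y : valued_set Q) := SetHom {
  set_dist :> distributor «X» «Y» ;
  set_dist_left_adjoint : left_adjoint set_dist
}.

Lemma set_hom_eq X Y (F G : set_hom X Y) :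
  F = G :> distributor «X» «Y» -> F = G.
Proof.
case: F G => [F Fl] [G Gl] /= FG; subst G.
by congr SetHom; apply: Prop_irrelevance.
Qed.

Definition set_comp X Y Z (G : set_hom Y Z) (F : set_hom X Y) : set_hom X Z :=
  SetHom (left_adjoint_comp (set_dist_left_adjoint G)
                            (set_dist_left_adjoint F)).

Definition set_id X : set_hom X X := SetHom (left_adjoint_id «X»).

Lemma set_compA X Y Z W (H : set_hom Z W) (G : set_hom Y Z)
    (F : set_hom X Y) :
  set_comp H (set_comp G F) = set_comp (set_comp H G) F.
Proof. by apply: set_hom_eq; apply: dcompA. Qed.

Lemma set_comp1l X Y (F : set_hom X Y) : set_comp (set_id Y) F = F.
Proof. by apply: set_hom_eq; apply: dcomp1l. Qed.

Lemma set_comp1r X Y (F : set_hom X Y) : set_comp F (set_id X) = F.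
Proof. by apply: set_hom_eq; apply: dcomp1r. Qed.

Definition SetQ : category := Category set_compA set_comp1l set_comp1r.

End ValuedSetCategory.

(* Main.v *)
Require Import Defs.
From mathcomp Require Import all_boot all_order.
From mathcomp Require Import boolp classical_sets.

(** Write [F°] for the converse of a distributor [F] between symmetric
    categories, obtained by transposing and applying the involution.

    A point [x] of the source of a left adjoint [F] gives a point of the Cauchy
    completion of the target, made of the values at [x] of [F] and of its right
    adjoint.  If completion preserves symmetry, comparing such points
    with the representable ones shows that the right adjoint is [F°]
    ([right_adjoint_dconv]).  Hence the morphisms of valued sets are the
    distributors [F] with [id ⊑ F° ⊗ F] and [F ⊗ F° ⊑ id], as maps in an
    allegory, and the factorization is the one of an allegory.

    - Image.  [F° ⊗ F] is a symmetric monad; splitting it as [q° ⊗ q] with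
      [q ⊗ q° = id] yields [F = (F ⊗ q°) ⊗ q], a covering morphism
      ([e ⊗ e° = id]) followed by an isometric one ([m° ⊗ m = id]).
    - Epimorphisms are the covering morphisms.  If [e] is epi, glue two copies
      of its target along the coreflexive [e ⊗ e°]: the two inclusions agree
      after [e], so they are equal, which forces [e ⊗ e° = id].
    - Extremal monomorphisms are the isometric morphisms: a factor [e] of an
      isometric [m = f ⊗ e] is isometric, and invertible once it is covering;
      conversely the covering part of an extremal mono is invertible.
    - Uniqueness.  In two factorizations [m1 ⊗ e1 = m2 ⊗ e2] both covering
      parts have the same kernel [e° ⊗ e], so [e2 ⊗ e1°] is an isomorphism.

    Splittings and gluings are built first as symmetric categories, with the
    types of points left unchanged, where [alpha x x] may lie strictly above the
    identity.  Every such category over [DQ Q] is isomorphic, through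
    distributors, to a valued set ([retype_conv_comp], [retype_comp_conv]). *)

Set Implicit Arguments.
Unset Strict Implicit.
Unset Printing Implicit Defensive.

Import Order.TTheory.

Local Open Scope classical_set_scope.
Local Open Scope order_scope.
Local Open Scope quantale_scope.

Reserved Notation "F °" (at level 1, left associativity, format "F °").
Reserved Notation "F ⊑ G" (at level 70, no associativity).

Local Notation "F ⊑ G" := (dle F G) : quantale_scope.

(** * Distributors and their order *)

Section DistributorOrder.
Context d (K : quantaloid d).
Implicit Types X Y Z : qcategory K.

Lemma dle_refl X Y (F : distributor X Y) : F ⊑ F.
Proof. by []. Qed.

Lemma dle_anti X Y (F G : distributor X Y) : F ⊑ G -> G ⊑ F -> F = G.
Proof.
by move=> FG GF; apply: distributor_eq => y x; apply/le_anti; rewrite FG GF.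
Qed.

Lemma qcomp_le_dcomp X Y Z (G : distributor Y Z) (F : distributor X Y) z y x :
  G z y ∘ F y x <= (G ⊗ F) z x.
Proof. exact: (bigvee_ub (fun y => G z y ∘ F y x)). Qed.

Lemma dle_dcompl X Y Z (F : distributor X Y) (G G' : distributor Y Z) :
  G ⊑ G' -> G ⊗ F ⊑ G' ⊗ F.
Proof. by move=> GG; apply: dcomp_le. Qed.

Lemma dle_dcompr X Y Z (G : distributor Y Z) (F F' : distributor X Y) :
  F ⊑ F' -> G ⊗ F ⊑ G ⊗ F'.
Proof. by move=> FF; apply: dcomp_le. Qed.

Lemma dcompl_le_id X Y (G : distributor Y Y) (F : distributor X Y) :
  G ⊑ did Y -> G ⊗ F ⊑ F.
Proof. by move/(dle_dcompl F); rewrite dcomp1l. Qed.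

Lemma dcompl_ge_id X Y (G : distributor Y Y) (F : distributor X Y) :
  did Y ⊑ G -> F ⊑ G ⊗ F.
Proof. by move/(dle_dcompl F); rewrite dcomp1l. Qed.

Lemma dcompr_ge_id X Y (F : distributor X Y) (G : distributor X X) :
  did X ⊑ G -> F ⊑ F ⊗ G.
Proof. by move/(dle_dcompr F); rewrite dcomp1r. Qed.

End DistributorOrder.

(** * The converse of a distributor between symmetric categories *)

Record symcat d (K : involutive_quantaloid d) := SymCat {
  symcat_cat :> qcategory K ;
  symcat_sym : qsymmetric symcat_cat
}.

Section Converse.
Context d (K : involutive_quantaloid d).
Implicit Types X Y Z : symcat K.

Lemma qinv_le (a b : qobj K) (f g : qhom a b) : f <= g -> qinv f <= qinv g.
Proof. exact: (join_preserving_le (@qinv_bigjoin d K a b)). Qed.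

Lemma qinv_bigvee (a b : qobj K) I (F : I -> qhom a b) :
  qinv (\bigvee_i F i) = \bigvee_i qinv (F i).
Proof. by rewrite qinv_bigjoin image_comp. Qed.

Section Def.
Context X Y (F : distributor X Y).

Fact dconv_actl x1 x2 y : alpha x1 x2 ∘ qinv (F y x2) <= qinv (F y x1).
Proof. by rewrite symcat_sym -qinv_comp; apply/qinv_le/dist_actr. Qed.

Fact dconv_actr x y1 y2 : qinv (F y1 x) ∘ alpha y1 y2 <= qinv (F y2 x).
Proof. by rewrite symcat_sym -qinv_comp; apply/qinv_le/dist_actl. Qed.

Definition dconv : distributor Y X := Distributor dconv_actl dconv_actr.

End Def.

Local Notation "F °" := (dconv F) : quantale_scope.

Lemma dconvK X Y (F : distributor X Y) : F°° = F.
Proof. by apply: distributor_eq => y x /=; rewrite qinvK. Qed.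

Lemma dconv_comp X Y Z (G : distributor Y Z) (F : distributor X Y) :
  (G ⊗ F)° = F° ⊗ G°.
Proof.
apply: distributor_eq => x z /=; rewrite /dcomp_fun qinv_bigvee.
by apply: eq_bigvee => y; rewrite qinv_comp.
Qed.

Lemma dconv_did X : (did X)° = did X.
Proof. by apply: distributor_eq => x y /=; rewrite -symcat_sym. Qed.

Lemma dconv_le X Y (F G : distributor X Y) : F ⊑ G -> F° ⊑ G°.
Proof. by move=> FG x y; apply/qinv_le/FG. Qed.

(** A left adjoint whose right adjoint is its converse: the analogue of a map
    in an allegory. *)
Definition dmap X Y (F : distributor X Y) : Prop :=
  did X ⊑ F° ⊗ F /\ F ⊗ F° ⊑ did Y.

Lemma dmap_left_adjoint X Y (F : distributor X Y) : dmap F -> left_adjoint F.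
Proof. by move=> Fmap; exists (F°). Qed.

Lemma dmap_comp X Y Z (G : distributor Y Z) (F : distributor X Y) :
  dmap G -> dmap F -> dmap (G ⊗ F).
Proof.
move=> [G1 G2] [F1 F2]; split; rewrite dconv_comp -dcompA.
  rewrite (dcompA (G°)); apply: dle_trans F1 _; apply: dle_dcompr.
  exact: dcompl_ge_id.
rewrite (dcompA F); apply: dle_trans _ G2; apply: dle_dcompr.
exact: dcompl_le_id.
Qed.

Lemma dmap_comp_conv X Y (F : distributor X Y) : dmap F -> F ⊗ F° ⊗ F = F.
Proof.
move=> [F1 F2]; apply: dle_anti; first exact: dcompl_le_id.
by rewrite -dcompA; apply: dcompr_ge_id.
Qed.

(** [F° ⊗ F] plays the role of the kernel of [F]: it is unchanged by composing
    with an isometric morphism, as a kernel is by composing with an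
    injection. *)
Lemma kernel_isometric_comp X Y Z (m : distributor Y Z) (e : distributor X Y) :
  m° ⊗ m = did Y -> (m ⊗ e)° ⊗ (m ⊗ e) = e° ⊗ e.
Proof. by move=> m1; rewrite dconv_comp -dcompA (dcompA m°) m1 dcomp1l. Qed.

(** * Right adjoints are converses *)

Section AdjointPresingleton.
Variables (X Y : qcategory K).
Variables (F : distributor X Y) (P : distributor Y X).
Hypotheses (FP : did X ⊑ P ⊗ F) (PF : F ⊗ P ⊑ did Y).

Fact adjoint_ps_unit (x : X) : qid (qtype x) <= \bigvee_y (P x y ∘ F y x).
Proof. exact: le_trans (alpha_id x) (FP x x). Qed.

Fact adjoint_ps_counit (x : X) (y1 y2 : Y) : F y1 x ∘ P x y2 <= alpha y1 y2.
Proof. exact: le_trans (qcomp_le_dcomp F P y1 x y2) (PF y1 y2). Qed.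

(** The point of the Cauchy completion of the target that an adjunction
    assigns to a point of its source. *)
Definition adjoint_presingleton (x : X) : presingleton Y :=
  Presingleton (dist_actr P x) (fun y1 y2 => dist_actl F y1 y2 x)
    (adjoint_ps_unit x) (adjoint_ps_counit x).

End AdjointPresingleton.

(** An adjunction and the identity adjunction of its target give points of one
    Cauchy completion.  The two hom-arrows between a point of the first kind
    and a point of the second are, by the unit laws of [⊗], the values of the
    right and of the left adjoint; symmetry of the completion says that they
    are converse to each other. *)
Lemma right_adjoint_dconv X Y (F : distributor X Y) (P : distributor Y X) :
  cauchy_preserves_symmetry K -> did X ⊑ P ⊗ F -> F ⊗ P ⊑ did Y -> P = F°.
Proof.
move=> sym FP PF; apply: distributor_eq => x y /=.
have id1 : did Y ⊑ did Y ⊗ did Y by rewrite dcomp1l.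
have id2 : did Y ⊗ did Y ⊑ did Y by rewrite dcomp1l.
have := sym Y (@symcat_sym _ _ Y)
  (adjoint_presingleton FP PF x) (adjoint_presingleton id1 id2 y).
rewrite /= /cauchy_alpha /=.
have -> : \bigvee_y' (P x y' ∘ alpha y' y) = (P ⊗ did Y) x y by [].
have -> : \bigvee_y' (alpha y y' ∘ F y' x) = (did Y ⊗ F) y x by [].
by rewrite dcomp1r dcomp1l.
Qed.

Lemma left_adjoint_dmap X Y (F : distributor X Y) :
  cauchy_preserves_symmetry K -> left_adjoint F -> dmap F.
Proof.
by move=> sym [P [FP PF]]; rewrite /dmap -(right_adjoint_dconv sym FP PF).
Qed.

(** * Images and cokernel pairs *)

Section MonadCategory.
Variables (X : symcat K) (E : distributor X X).
Hypotheses (E1 : did X ⊑ E) (EE : E ⊗ E ⊑ E) (Esym : E° = E).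

Fact monad_alpha_comp (x y z : X) : E x y ∘ E y z <= E x z.
Proof. exact: le_trans (qcomp_le_dcomp E E x y z) (EE x z). Qed.

Fact monad_alpha_id (x : X) : qid (qtype x) <= E x x.
Proof. exact: le_trans (alpha_id x) (E1 x x). Qed.

Definition monad_cat : qcategory K := QCategory monad_alpha_comp monad_alpha_id.

Fact monad_cat_sym : qsymmetric monad_cat.
Proof. by move=> x y /=; rewrite -{1}Esym. Qed.

Definition monad_symcat : symcat K := SymCat monad_cat_sym.

Definition monad_proj : distributor X monad_symcat :=
  @Distributor d K X monad_symcat E monad_alpha_comp (dist_actr E).

End MonadCategory.

(** A symmetric monad in distributors splits: its underlying matrix is a
    hom-matrix on the same typed set, and is then also a distributor onto the
    new category. *)
Lemma symmetric_monad_split X (E : distributor X X) :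
  did X ⊑ E -> E ⊗ E ⊑ E -> E° = E ->
  exists (Y : symcat K) (q : distributor X Y),
    q° ⊗ q = E /\ q ⊗ q° = did Y.
Proof.
move=> E1 EE Esym; exists (monad_symcat E1 EE Esym), (monad_proj E1 EE Esym).
have EEE : E ⊗ E = E.
  by apply: dle_anti => //; apply: dcompr_ge_id.
have Einv x y : qinv (E y x) = E x y by rewrite -{2}Esym.
split; apply: distributor_eq => x y /=; rewrite /dcomp_fun /=.
  by under eq_bigvee do rewrite Einv; rewrite -{3}EEE.
by under eq_bigvee do rewrite Einv; rewrite -{3}EEE.
Qed.

Section Amalgam.
Variables (X : symcat K) (p : distributor X X).
Hypotheses (p1 : p ⊑ did X) (psym : p° = p).

Let G (same : bool) : distributor X X := if same then did X else p.

Fact amalgam_comp_le (b1 b2 b3 : bool) :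
  G (b1 == b2) ⊗ G (b2 == b3) ⊑ G (b1 == b3).
Proof.
have pp : p ⊗ p ⊑ did X.
  by rewrite -[did X]dcomp1l; apply: dcomp_le.
by case: b1 b2 b3 => [] [] []; rewrite /G /= ?dcomp1l ?dcomp1r.
Qed.

Fact amalgam_alpha_comp (x y z : X * bool) :
  G (x.2 == y.2) x.1 y.1 ∘ G (y.2 == z.2) y.1 z.1 <= G (x.2 == z.2) x.1 z.1.
Proof.
apply: le_trans (amalgam_comp_le x.2 y.2 z.2 x.1 z.1).
exact: (qcomp_le_dcomp (G (x.2 == y.2)) (G (y.2 == z.2))).
Qed.

Fact amalgam_alpha_id (x : X * bool) : qid (qtype x.1) <= G (x.2 == x.2) x.1 x.1.
Proof. by rewrite eqxx; apply: alpha_id. Qed.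

(** Two copies of a category, glued along a coreflexive.  The boolean tells the
    copies apart; unlike a disjoint sum, this encoding lets the type map and the
    inclusions be defined without case analysis. *)
Definition amalgam : qcategory K :=
  @QCategory d K (X * bool)%type (fun x => qtype x.1)
    (fun x y => G (x.2 == y.2) x.1 y.1) amalgam_alpha_comp amalgam_alpha_id.

Lemma amalgam_inv same x y : G same x y = qinv (G same y x).
Proof.
by case: same; rewrite /G /=; [apply: symcat_sym | rewrite -{1}psym].
Qed.

Fact amalgam_sym : qsymmetric amalgam.
Proof. by move=> x y; rewrite /= eq_sym; apply: amalgam_inv. Qed.

Definition amalgam_symcat : symcat K := SymCat amalgam_sym.

Fact amalgam_in_actl b (w1 w2 : amalgam) (x : X) :
  alpha w1 w2 ∘ G (w2.2 == b) w2.1 x <= G (w1.2 == b) w1.1 x.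
Proof. exact: (amalgam_alpha_comp w1 w2 (x, b)). Qed.

Fact amalgam_in_actr b (w : amalgam) (x1 x2 : X) :
  G (w.2 == b) w.1 x1 ∘ alpha x1 x2 <= G (w.2 == b) w.1 x2.
Proof. exact: dist_actr. Qed.

Definition amalgam_in b : distributor X amalgam_symcat :=
  @Distributor d K X amalgam_symcat (fun w x => G (w.2 == b) w.1 x)
    (amalgam_in_actl b) (amalgam_in_actr b).

Lemma amalgam_in_dmap b : dmap (amalgam_in b).
Proof.
split=> [x y|w1 w2].
  apply: (@bigvee_ub_le _ _ _ _ ((x, b) : amalgam)).
  rewrite /= eqxx -amalgam_inv /G /= -{1}[alpha x y]qcomp1l.
  exact: qcomp_le (alpha_id x) _.
apply: bigvee_le => x; rewrite /= -amalgam_inv [w2.2 == b]eq_sym.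
exact: (amalgam_alpha_comp w1 (x, b) w2).
Qed.

Lemma amalgam_in_equalizes Z (F : distributor Z X) :
  p ⊗ F = F -> amalgam_in true ⊗ F = amalgam_in false ⊗ F.
Proof.
move=> pF.
have GF s : G s ⊗ F = F by case: s; rewrite /G ?dcomp1l.
have inF b w z : (amalgam_in b ⊗ F) w z = F w.1 z.
  by rewrite -[in RHS](GF (w.2 == b)).
by apply: distributor_eq => w z; rewrite !inF.
Qed.

Lemma amalgam_in_eq : amalgam_in true = amalgam_in false -> p = did X.
Proof.
move=> inE; apply: distributor_eq => x y.
by have := congr1 (fun F : distributor X amalgam_symcat => F (x, true) y) inE.
Qed.

End Amalgam.

(** The two inclusions into the gluing along [p] serve as a cokernel pair of
    the subobject fixed by [p]: they turn the cancellation property of an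
    epimorphism with range [p] into [p = did X]. *)
Lemma coreflexive_cokernel_pair X (p : distributor X X) :
  p ⊑ did X -> p° = p ->
  exists (Y : symcat K) (i j : distributor X Y), [/\ dmap i, dmap j,
    forall Z (F : distributor Z X), p ⊗ F = F -> i ⊗ F = j ⊗ F &
    i = j -> p = did X].
Proof.
move=> p1 psym; exists (amalgam_symcat p1 psym).
exists (amalgam_in p1 psym true), (amalgam_in p1 psym false).
split; [exact: amalgam_in_dmap | exact: amalgam_in_dmap | |].
  by move=> Z F; apply: amalgam_in_equalizes.
exact: amalgam_in_eq.
Qed.

End Converse.

Local Notation "F °" := (dconv F) : quantale_scope.

(** * Symmetric categories over an involutive quantale are valued sets *)

Canonical symcat_of_valued_set d (Q : involutiveQuantaleType d)
    (X : valued_set Q) : symcat (DQ Q) :=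
  SymCat (@qcategory_of_valued_set_sym d Q X).

Section ValuedSetOfSymcat.
Context d (Q : involutiveQuantaleType d).

Lemma dq_val_bigvee (a b : dq_obj Q) I (F : I -> @qhom d (DQ Q) a b) :
  (dq_val (\bigvee_i F i) : Q) = \bigvee_i (dq_val (F i) : Q).
Proof. by rewrite /bigjoin /= image_comp. Qed.

Lemma dq_val_dcomp (X Y Z : qcategory (DQ Q)) (G : distributor Y Z)
    (F : distributor X Y) z x :
  dq_val ((G ⊗ F) z x) = \bigvee_y (dq_val (G z y ∘ F y x) : Q).
Proof. exact: dq_val_bigvee. Qed.

(** Retyping the middle object does not change composites: in the product of
    [m ↙ b], [b'] and [b' ↘ l'], the last two factors multiply to [l']
    because [l'] is divisible by [b'], and what is left is the composite over
    [b]. *)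
Lemma dq_comp_middle (a b c a' b' c' : dq_obj Q)
    (m : dq_hom b c) (l : dq_hom a b) (m' : dq_hom b' c') (l' : dq_hom a' b') :
  m' = m :> Q -> l' = l :> Q ->
  (m : Q) = (((m : Q) ↙ (b : Q)) * (b' : Q))%g ->
  dq_comp m' l' = dq_comp m l :> Q.
Proof.
move=> mE lE mb'; rewrite [RHS]dq_comp_lresidual /= mE {1}mb' -mulgA lE.
by rewrite -lE -dq_hom_tgt.
Qed.

Variable A : symcat (DQ Q).

Let e (x y : A) : Q := dq_val (alpha x y).

Let e_sym x y : e x y = invol (e y x).
Proof. by rewrite /e [in LHS]symcat_sym. Qed.

Let alpha_compl (x y : A) : alpha x x ∘ alpha x y = alpha x y.
Proof.
apply/le_anti/andP; split; first exact: alpha_comp.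
rewrite -{1}[alpha x y]qcomp1l; exact: qcomp_le (alpha_id x) _.
Qed.

Let alpha_compr (x y : A) : alpha x y ∘ alpha y y = alpha x y.
Proof.
apply/le_anti/andP; split; first exact: alpha_comp.
rewrite -{1}[alpha x y]qcomp1r; exact: qcomp_le _ (alpha_id y).
Qed.

Let e_tgt x y : e x y = (e x x * (dq_elt (qtype x) ↘ e x y))%g.
Proof. by rewrite {1}/e -alpha_compl. Qed.

Let e_src x y : e x y = ((e x y ↙ dq_elt (qtype y)) * e y y)%g.
Proof. by rewrite {1}/e -alpha_compr [LHS]dq_comp_lresidual. Qed.

Let e_divl x y : (e x x * (e x x ↘ e x y))%g = e x y.
Proof. by rewrite -rdivisibleP //; eexists; apply: e_tgt. Qed.

Let e_divr x y : e x y = ((e x y ↙ e y y) * e y y)%g.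
Proof. by apply: ldivisibleP; eexists; apply: e_src. Qed.

Let e_middle x y z :
  (e x y * (e y y ↘ e y z))%g = dq_val (alpha x y ∘ alpha y z).
Proof.
by rewrite [RHS]dq_comp_lresidual /= -/(e x y) {1}e_src -mulgA e_divl.
Qed.

Let e_trans x y z : (e x y * (e y y ↘ e y z))%g <= e x z.
Proof. by rewrite e_middle; have := alpha_comp x y z; rewrite leEsub. Qed.

(** The self-distance [alpha x x] is a symmetric idempotent above the identity
    of [qtype x], hence itself self-divisible and hermitian.  Retyping every
    point by it makes the hom-matrix a valued set. *)
Definition valued_set_of_symcat : valued_set Q :=
  ValuedSet e_divl e_divr e_trans e_sym.

Let W : symcat (DQ Q) := symcat_of_valued_set valued_set_of_symcat.

Fact retype_is_dq_hom (w x : A) :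
  is_dq_hom (dq_elt (qtype x)) (e w w) (e w x).
Proof.
apply/is_dq_homP; split; last by eexists; apply: e_tgt.
by eexists; apply: (dq_hom_src (alpha w x)).
Qed.

Definition retype_hom (w : W) (x : A) : @qhom d (DQ Q) (qtype x) (qtype w) :=
  @DqHom d Q (qtype x) (qtype w) (e w x) (retype_is_dq_hom w x).

Fact retype_actl (w1 w2 : W) (x : A) :
  alpha w1 w2 ∘ retype_hom w2 x <= retype_hom w1 x.
Proof. by rewrite leEsub; apply: e_trans. Qed.

Fact retype_actr (w : W) (x1 x2 : A) :
  retype_hom w x1 ∘ alpha x1 x2 <= retype_hom w x2.
Proof. by rewrite leEsub; have := alpha_comp (w : A) x1 x2; rewrite leEsub. Qed.

(** The hom-matrix itself, read as a distributor from the old types to the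
    new ones. *)
Definition retype : distributor A W := Distributor retype_actl retype_actr.

Lemma retype_conv_comp : retype° ⊗ retype = did A.
Proof.
rewrite -[RHS]dcomp1l; apply: distributor_eq => x y; apply: dq_hom_inj.
rewrite !dq_val_dcomp; apply: eq_bigvee => w.
refine (@dq_comp_middle _ _ _ _ _ _ (did A x w) (did A w y)
  (retype° x w) (retype w y) _ _ _) => //.
  by rewrite /= -e_sym.
exact: e_src.
Qed.

Lemma retype_comp_conv : retype ⊗ retype° = did W.
Proof.
apply: distributor_eq => x y; apply: dq_hom_inj.
rewrite -[RHS]/(dq_val (did A x y)) -[did A]dcomp1l.
rewrite !dq_val_dcomp; apply: eq_bigvee => w.
by rewrite /= -e_sym.
Qed.

End ValuedSetOfSymcat.

(** * Epimorphisms and extremal monomorphisms of valued sets *)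

Section SetFactorization.
Context d (Q : involutiveQuantaleType d).
Implicit Types X Y Z : valued_set Q.

Local Notation "« X »" := (symcat_of_valued_set X) (format "« X »").

Definition dmap_hom X Y (F : distributor «X» «Y») (Fmap : dmap F) :
  set_hom X Y := SetHom (dmap_left_adjoint Fmap).

(** Every symmetric category is isomorphic to a valued set, so the splitting of
    a symmetric monad can be taken there. *)
Lemma symmetric_monad_split_valued X (E : distributor «X» «X») :
  did «X» ⊑ E -> E ⊗ E ⊑ E -> E° = E ->
  exists (Y : valued_set Q) (q : distributor «X» «Y»),
    q° ⊗ q = E /\ q ⊗ q° = did «Y».
Proof.
move=> E1 EE Esym; have [A [q [qE q1]]] := symmetric_monad_split E1 EE Esym.
exists (valued_set_of_symcat A), (retype A ⊗ q).
rewrite dconv_comp; split.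
  by rewrite -dcompA (dcompA (retype A)°) retype_conv_comp dcomp1l.
by rewrite -dcompA (dcompA q) q1 dcomp1l retype_comp_conv.
Qed.

(** Covering morphisms are split epimorphisms among all distributors, although
    the splitting [e°] need not be a morphism of valued sets; dually for
    isometric ones. *)
Lemma covering_epi X Y (e : set_hom X Y) :
  e ⊗ e° = did «Y» -> epimorphism (C := SetQ Q) e.
Proof.
move=> e1 Z f g /(congr1 (@set_dist d Q X Z)) /= fege; apply: set_hom_eq.
have : f ⊗ e ⊗ e° = g ⊗ e ⊗ e° by rewrite fege.
by rewrite -!dcompA e1 !dcomp1r.
Qed.

Lemma isometric_mono X Y (m : set_hom X Y) :
  m° ⊗ m = did «X» -> monomorphism (C := SetQ Q) m.
Proof.
move=> m1 Z f g /(congr1 (@set_dist d Q Z Y)) /= mfmg; apply: set_hom_eq.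
have : m° ⊗ (m ⊗ f) = m° ⊗ (m ⊗ g) by rewrite mfmg.
by rewrite !dcompA m1 !dcomp1l.
Qed.

Lemma covering_isometric_iso X Y (h : set_hom X Y) :
  h° ⊗ h = did «X» -> h ⊗ h° = did «Y» -> isomorphism (C := SetQ Q) h.
Proof.
move=> hh1 hh2; have hcmap : dmap (h°).
  by rewrite /dmap dconvK hh1 hh2; split; apply: dle_refl.
by exists (dmap_hom hcmap); split; apply: set_hom_eq.
Qed.

Hypothesis sym : cauchy_preserves_symmetry (DQ Q).

Lemma set_hom_dmap X Y (F : set_hom X Y) : dmap (F : distributor «X» «Y»).
Proof. exact: left_adjoint_dmap sym (set_dist_left_adjoint F). Qed.

(** The range [e ⊗ e°] of [e] is a coreflexive fixing [e], so the two
    inclusions into the gluing along it become equal after [e]. *)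
Lemma epi_covering X Y (e : set_hom X Y) :
  epimorphism (C := SetQ Q) e -> e ⊗ e° = did «Y».
Proof.
move=> epi; have emap := set_hom_dmap e.
have [|A [i [j [imap jmap ij]]]] := coreflexive_cokernel_pair emap.2.
  by rewrite dconv_comp dconvK.
apply.
have umap : dmap (retype A).
  by split; rewrite ?retype_conv_comp ?retype_comp_conv.
have uij : retype A ⊗ i = retype A ⊗ j.
  pose ui := dmap_hom (dmap_comp umap imap).
  pose uj := dmap_hom (dmap_comp umap jmap).
  suff /epi /(congr1 (@set_dist d Q _ _)) : set_comp ui e = set_comp uj e by [].
  by apply: set_hom_eq; rewrite /= -!dcompA ij // dmap_comp_conv.
have : (retype A)° ⊗ (retype A ⊗ i) = (retype A)° ⊗ (retype A ⊗ j).
  by rewrite uij.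
by rewrite !dcompA retype_conv_comp !dcomp1l.
Qed.

(** If [m = f ⊗ e] then [e° ⊗ e ⊑ m° ⊗ m], so an isometric [m] makes [e]
    isometric, and an epimorphism [e] is covering already. *)
Lemma isometric_extremal X Y (m : set_hom X Y) :
  m° ⊗ m = did «X» -> extremal_monomorphism (C := SetQ Q) m.
Proof.
move=> m1; split=> [|Z f e mE epi]; first exact: isometric_mono.
apply: covering_isometric_iso; last exact: epi_covering.
apply: dle_anti; last exact: (set_hom_dmap e).1.
rewrite -m1 mE /= dconv_comp -dcompA (dcompA f°).
by apply: dle_dcompr; apply: dcompl_ge_id; apply: (set_hom_dmap f).1.
Qed.

(** The image of [F] splits the symmetric monad [F° ⊗ F], the kernel of [F]. *)
Lemma image_factorization X Y (F : set_hom X Y) :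
  exists (Z : valued_set Q) (e : set_hom X Z) (m : set_hom Z Y),
    [/\ e ⊗ e° = did «Z», m° ⊗ m = did «Z» & F = set_comp m e].
Proof.
have Fmap := set_hom_dmap F.
have [||Z [q [qE q1]]] := symmetric_monad_split_valued Fmap.1.
- by rewrite -dcompA (dcompA F) dmap_comp_conv.
- by rewrite dconv_comp dconvK.
have qmap : dmap q.
  by rewrite /dmap qE q1; split; [exact: Fmap.1 | exact: dle_refl].
have m1 : (F ⊗ q°)° ⊗ (F ⊗ q°) = did «Z».
  rewrite dconv_comp dconvK -dcompA (dcompA F°) -qE -(dcompA q°).
  by rewrite q1 dcomp1r q1.
have mmap : dmap (F ⊗ q°).
  rewrite /dmap m1; split; first exact: dle_refl.
  rewrite dconv_comp dconvK -dcompA (dcompA q°) qE.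
  by rewrite !dcompA dmap_comp_conv //; apply: Fmap.2.
exists Z, (dmap_hom qmap), (dmap_hom mmap); split=> //; apply: set_hom_eq.
have FE : F ⊗ q° ⊗ q = F by rewrite -dcompA qE dcompA dmap_comp_conv.
exact: esym FE.
Qed.

(** Extremality makes the covering part of the image factorization of [m]
    invertible, hence isometric. *)
Lemma extremal_isometric X Y (m : set_hom X Y) :
  extremal_monomorphism (C := SetQ Q) m -> m° ⊗ m = did «X».
Proof.
move=> [_ ext]; have [Z [e [n [e1 n1 mE]]]] := image_factorization m.
have [k [/(congr1 (@set_dist d Q _ _)) /= ke _]] := ext _ _ _ mE (covering_epi e1).
have kE : k = e° :> distributor _ _.
  by rewrite -[e°]dcomp1l -ke -dcompA e1 dcomp1r.
by rewrite mE (kernel_isometric_comp _ n1) -kE.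
Qed.

(** Both covering parts split the kernel of the common composite, so they are
    compared by going back along one and forth along the other. *)
Lemma factorization_unique X Y Z1 Z2 (e1 : set_hom X Z1) (m1 : set_hom Z1 Y)
    (e2 : set_hom X Z2) (m2 : set_hom Z2 Y) :
  e1 ⊗ e1° = did «Z1» -> m1° ⊗ m1 = did «Z1» ->
  e2 ⊗ e2° = did «Z2» -> m2° ⊗ m2 = did «Z2» ->
  m1 ⊗ e1 = m2 ⊗ e2 ->
  exists h : set_hom Z1 Z2, [/\ isomorphism (C := SetQ Q) h,
    set_comp h e1 = e2 & set_comp m2 h = m1].
Proof.
move=> e1c m1i e2c m2i mE.
have kerE : e1° ⊗ e1 = e2° ⊗ e2.
  by rewrite -(kernel_isometric_comp e1 m1i) mE kernel_isometric_comp.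
pose h := e2 ⊗ e1°.
have hh1 : h° ⊗ h = did «Z1».
  rewrite dconv_comp dconvK -dcompA (dcompA e2°) -kerE -(dcompA e1°).
  by rewrite e1c dcomp1r e1c.
have hh2 : h ⊗ h° = did «Z2».
  rewrite dconv_comp dconvK -dcompA (dcompA e1°) kerE -(dcompA e2°).
  by rewrite e2c dcomp1r e2c.
have hmap : dmap h by rewrite /dmap hh1 hh2; split; apply: dle_refl.
have he1 : h ⊗ e1 = e2 by rewrite -dcompA kerE dcompA e2c dcomp1l.
have m2h : m2 ⊗ h = m1 by rewrite dcompA -mE -dcompA e1c dcomp1r.
exists (dmap_hom hmap); split; first exact: covering_isometric_iso.
  by apply: set_hom_eq; exact: he1.
by apply: set_hom_eq; exact: m2h.
Qed.

End SetFactorization.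

Theorem theorem7p1 (d : Order.disp_t) (Q : involutiveQuantaleType d) :
  cauchy_preserves_symmetry (DQ Q) -> epi_extremal_mono_category (SetQ Q).
Proof.
move=> sym; split=> [X Y F|X Y Z1 Z2 e1 m1 e2 m2 epi1 ext1 epi2 ext2 mE].
  have [Z [e [m [e1 m1 FE]]]] := image_factorization sym F.
  by exists Z, e, m; split; [exact: covering_epi | exact: isometric_extremal |].
apply: (factorization_unique (epi_covering sym epi1)
  (extremal_isometric sym ext1) (epi_covering sym epi2)
  (extremal_isometric sym ext2)).
exact: (congr1 (@set_dist d Q X Y) mE).
Qed.
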